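(* Let $\mathcal{A}$ be a complex unital $C^*$-algebra, let $x,y,z\in\mathcal{A}$ and let $\phi$ be a sub-multiplicative Orlicz function. If $x,z$ are positive, $r\ge2$ is real and $0\le\alpha\le1$, then $$\phi\Big(v^r\big(x^{\alpha}yz^{1-\alpha}\big)\Big)\le\phi\big(\|y\|^r\big)\,\Big\|\alpha\phi(x^r)+(1-\alpha)\phi(z^r)\Big\| .$$
   Context: $\mathbf 1$ is the unit of $\mathcal{A}$. $\mathcal{S}(\mathcal{A})=\{g\in\mathcal{A}^*: g(x^*x)\ge0\ \text{for all } x\in\mathcal{A},\ g(\mathbf 1)=1\}$ is the set of states and $v(x)=\sup\{|g(x)|: g\in\mathcal{S}(\mathcal{A})\}$ is the (algebraic) numerical radius; $v^r(x)$ means $(v(x))^r$. An Orlicz function is a map $\phi:[0,\infty)\to[0,\infty)$ that is continuous, convex, non-decreasing, with $\phi(0)=0$ and $\phi(u)\to\infty$ as $u\to\infty$; it is always assumed non-degenerate, i.e. $\phi(u)>0$ for $u>0$. It is sub-multiplicative if $\phi(uv)\le\phi(u)\phi(v)$ for all $u,v\ge0$. For a positive element $y$, $\phi(y)$ and real powers $y^s$ ($s\ge 0$, with $y^0=\mathbf 1$) are defined by continuous functional calculus. *)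

(* Defs.v *)
From HB Require Import structures.
From mathcomp Require Import all_boot all_order all_algebra.
From mathcomp Require Import all_classical all_reals all_analysis.
From mathcomp Require Import complex.

Set Implicit Arguments.
Unset Strict Implicit.
Unset Printing Implicit Defensive.
Import Order.TTheory GRing.Theory Num.Theory.
Import numFieldNormedType.Exports.

Local Open Scope classical_set_scope.
Local Open Scope ring_scope.
Local Open Scope complex_scope.
Import ComplexField.

HB.mixin Record isCStarAlgebra (R : realType) A of GRing.Algebra R[i] A := {
  cnorm : A -> R ;
  cnorm_ge0 : forall a, 0 <= cnorm a ;
  cnorm0_eq0 : forall a, cnorm a = 0 -> a = 0 ;
  ler_cnormD : forall a b, cnorm (a + b) <= cnorm a + cnorm b ;
  cnormZ : forall (c : R[i]) a, cnorm (c *: a) = Normc.normc c * cnorm a ;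
  ler_cnormM : forall a b, cnorm (a * b) <= cnorm a * cnorm b ;
  cnorm_complete : forall u : nat -> A,
    (forall e : R, 0 < e -> exists N, forall m n,
       (N <= m)%N -> (N <= n)%N -> cnorm (u m - u n) < e) ->
    exists l, (fun n => cnorm (u n - l)) @ \oo --> (0 : R) ;
  star : A -> A ;
  starD : forall a b, star (a + b) = star a + star b ;
  starZ : forall (c : R[i]) a, star (c *: a) = c^* *: star a ;
  starM : forall a b, star (a * b) = star b * star a ;
  starK : involutive star ;
  cnorm_star : forall a, cnorm (star a * a) = cnorm a ^+ 2
}.

(* The norm is a field of the mixin because Hierarchy Builder rejects a common
   structure of rings and of normed modules other than `numDomainType`.
   As `algType` requires `1 != 0`, the zero algebra is excluded. *)
#[short(type="cstarAlgType")]
HB.structure Definition CStarAlgebra (R : realType) :=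
  {A of isCStarAlgebra R A & GRing.Algebra R[i] A}.

Section cstar_algebra.
Context {R : realType} {A : cstarAlgType R}.
Implicit Types (a b x : A) (f g : R[i]^o -> R[i]^o).

(* The first condition is the continuity of g; in the second, `0 <= g _` in R[i]
   means that g _ is real and nonnegative. *)
Definition states : set {linear A -> R[i]^o} :=
  [set g | [/\ exists M : R, forall x, Normc.normc (g x) <= M * cnorm x,
               forall x, 0 <= g (star x * x) & g 1 = 1]].

Definition numerical_radius x : R :=
  sup [set Normc.normc (g x) | g in states].

Definition spectrum a : set R[i]^o :=
  [set l | ~ exists b, (l%:A - a) * b = 1 /\ b * (l%:A - a) = 1].

Definition positive a : Prop := star a = a /\ spectrum a `<=` [set l | 0 <= l].

Definition continuous_on_spectrum a f : Prop := {within spectrum a, continuous f}.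

(* The unital *-homomorphism C(sp a) -> A that maps the identity function to a;
   it exists, and is then unique, if and only if a is normal.  An element of
   C(sp a) is represented by any function that restricts to it. *)
Record is_functional_calculus a (Phi : (R[i]^o -> R[i]^o) -> A) : Prop := {
  fcalc_ext : forall f g,
    continuous_on_spectrum a f -> continuous_on_spectrum a g ->
    {in spectrum a, f =1 g} -> Phi f = Phi g ;
  fcalcD : forall f g,
    continuous_on_spectrum a f -> continuous_on_spectrum a g ->
    Phi (f \+ g) = Phi f + Phi g ;
  fcalcZ : forall (c : R[i]) f, continuous_on_spectrum a f ->
    Phi (fun l => c * f l) = c *: Phi f ;
  fcalcM : forall f g,
    continuous_on_spectrum a f -> continuous_on_spectrum a g ->
    Phi (f \* g) = Phi f * Phi g ;
  fcalc_star : forall f, continuous_on_spectrum a f ->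
    Phi (fun l => (f l)^*) = star (Phi f) ;
  fcalc1 : Phi (fun=> 1) = 1 ;
  fcalc_id : Phi id = a
}.

(* Junk values if a is not normal or h is not continuous on the spectrum. *)
Definition functional_calculus a : (R[i]^o -> R[i]^o) -> A :=
  xget (fun=> 0) [set Phi | is_functional_calculus a Phi].

(* For a positive, only the values of h on [0, +oo[ matter. *)
Definition real_calculus (h : R -> R) a : A :=
  functional_calculus a (fun l => (h (complex.Re l))%:C).

(* `powR` satisfies 0 `^ 0 = 1, hence real_power a 0 = 1 for a positive. *)
Definition real_power a (s : R) : A := real_calculus (fun u => u `^ s) a.

End cstar_algebra.

(* A function [0, +oo[ -> [0, +oo[ is represented by phi : R -> R, whose values
   on negative numbers are irrelevant. *)
Definition orlicz_function {R : realType} (phi : R -> R) : Prop :=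
  [/\ (forall u, 0 <= u -> 0 <= phi u),
      {within `[0, +oo[, continuous phi},
      convex_function (`[0, +oo[%classic : set R) phi,
      (forall u v, 0 <= u -> u <= v -> phi u <= phi v) &
      [/\ phi 0 = 0, phi u @[u --> +oo] --> +oo & forall u, 0 < u -> 0 < phi u]].

Definition sub_multiplicative {R : realType} (phi : R -> R) : Prop :=
  forall u v, 0 <= u -> 0 <= v -> phi (u * v) <= phi u * phi v.

(* Main.v *)
Require Import Defs.
From mathcomp Require Import all_boot all_order all_algebra.
From mathcomp Require Import all_classical all_reals all_analysis.
From mathcomp Require Import complex ring lra.

(* For a state g, the Cauchy-Schwarz inequality gives
     |g(x^alpha y z^(1-alpha))|^2 <= |y|^2 g(x^(2 alpha)) g(z^(2(1-alpha))).
   Since r >= 2, Jensen's inequality for g on the functional calculus of x yields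
   g(x^(2 alpha))^(r/2) <= g(x^r)^alpha, likewise for z, so by the weighted AM-GM
   inequality |g(x^alpha y z^(1-alpha))|^r <= |y|^r (alpha g(x^r) + (1-alpha) g(z^r)).
   Now apply phi, use sub-multiplicativity, convexity, and Jensen's inequality
   phi(g(x^r)) <= g(phi(x^r)), and take the supremum over g.

   Gelfand theory is avoided: if x or z had no functional calculus, then its powers
   would be the junk value 0 and the left-hand side phi 0 = 0.  A functional calculus
   of x, once given, is composed with t |-> t^r into one of x^r, which only requires
   an inclusion of the spectral mapping theorem. *)

Set Implicit Arguments.
Unset Strict Implicit.
Unset Printing Implicit Defensive.
Import Order.TTheory GRing.Theory Num.Theory.
Import numFieldNormedType.Exports.
Import ComplexField.

Local Open Scope classical_set_scope.
Local Open Scope ring_scope.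
Local Open Scope complex_scope.

(** * Continuity *)

Section continuity.
Context {R : realType}.
Implicit Types (h k : R -> R).

Lemma Re_continuous : continuous (@complex.Re R : R[i]^o -> R).
Proof.
move=> l; apply/(cvgrPdist_lt (FF := nbhs_filter (l : R[i]^o))) => e e0.
have e0C : 0 < e%:C :> R[i] by rewrite ltcR.
have /(cvgrPdist_lt (FF := nbhs_filter (l : R[i]^o)))/(_ _ e0C) :
  nbhs (l : R[i]^o) --> (l : R[i]^o) by exact: cvg_id.
apply: filterS => m lm; rewrite -ltcR.
have -> : complex.Re l - complex.Re m = complex.Re ((l : R[i]) - (m : R[i]))
  by case: l m {lm} => ? ? [].
exact: le_lt_trans (normc_ge_Re _) lm.
Qed.

Lemma real_complex_continuous : continuous (fun t : R => t%:C : R[i]^o).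
Proof.
move=> t; apply/cvgrPdist_lt => e e0.
(* The norm of [R[i]^o] takes values in [R[i]], so [e] is complex; being positive, it is real. *)
have eE : e = (complex.Re e)%:C by rewrite RRe_real// gtr0_real.
near=> s.
rewrite -rmorphB normc_def /= expr0n /= addr0 sqrtr_sqr eE ltcR.
near: s; apply: cvgr_dist_lt => //; rewrite -ltcR -eE.
Unshelve. all: by end_near. Qed.

(** Replaces the relative continuity in [orlicz_function] by continuity on all of [R], via the even
    extension. *)
Lemma within_continuous_norm h :
  {within `[0, +oo[, continuous h} -> continuous (fun t : R => h `|t|).
Proof.
move=> /subspace_continuousP hc t.
have t0 : `[0, +oo[%classic `|t| by rewrite /= in_itv /= andbT.
apply: cvg_comp (hc _ t0) => P /norm_continuous.
by apply: (filterS (F := nbhs t)) => s; apply; rewrite /= in_itv /= andbT.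
Qed.

End continuity.

(** * Positive functionals *)

Lemma normc_ge0 (R : realType) (u : R[i]) : 0 <= Normc.normc u.
Proof. by case: u => p q; exact: sqrtr_ge0. Qed.

Lemma Re_le_normc (R : realType) (u : R[i]) : complex.Re u <= Normc.normc u.
Proof.
case: u => p q /=; apply: le_trans (ler_norm _) _.
by rewrite -sqrtr_sqr ler_sqrt ?addr_ge0 ?sqr_ge0// lerDl sqr_ge0.
Qed.

Lemma normc_sqr (R : realType) (u : R[i]) :
  Normc.normc u ^+ 2 = complex.Re u ^+ 2 + complex.Im u ^+ 2.
Proof. by case: u => a b /=; rewrite sqr_sqrtr// addr_ge0// sqr_ge0. Qed.

Lemma ge0_complexP (R : realType) (u : R[i]) : 0 <= u -> u = (complex.Re u)%:C /\ 0 <= complex.Re u.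
Proof. by case: u => a b; rewrite lecE /= => /andP[/eqP -> ->]. Qed.

(** The form is g((a + c b)^* (a + c b)) expanded in c. The imaginary parts at c = 1 and c = i force
    v = u^*; then c = - t u^* with t real leaves the real quadratic p - 2 t |u|^2 + t^2 |u|^2 q. *)
Lemma quadratic_form_ge0 (R : realType) (p q u v : R[i]) :
  0 <= p -> 0 <= q ->
  (forall c : R[i], 0 <= p + c * u + c^* * v + c * c^* * q) ->
  v = u^* /\ Normc.normc u ^+ 2 <= complex.Re p * complex.Re q.
Proof.
move=> /ge0_complexP[-> p0] /ge0_complexP[-> q0]; rewrite normc_sqr /=.
move: (complex.Re p) (complex.Re q) p0 q0 => {}p {}q p0 q0.
case: u v => [a b] [c d] H.
have /andP[/eqP e1 _] : (b + d == 0) && (0 <= p + (a + c) + q).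
  by have := H 1; rewrite lecE /=; congr (_ && _); [congr (_ == _)|congr (_ <= _)]; ring.
have /andP[/eqP e2 _] : (a - c == 0) && (0 <= p + (d - b) + q).
  by have := H 'i; rewrite lecE /=; congr (_ && _); [congr (_ == _)|congr (_ <= _)]; ring.
have -> : d = - b by lra.
have -> : c = a by lra.
split => //=.
have K t : 0 <= p - 2 * t * (a ^+ 2 + b ^+ 2) + t ^+ 2 * (a ^+ 2 + b ^+ 2) * q.
  have /andP[_] := H ((- t * a) +i* (t * b)).
  rewrite /= (_ : d = -b); last lra; rewrite (_ : c = a); last lra.
  by congr (_ <= _); ring.
move: (a ^+ 2 + b ^+ 2) (addr_ge0 (sqr_ge0 a) (sqr_ge0 b)) K => n n0 K.
have [q00|qn0] := eqVneq q 0.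
  subst q; rewrite mulr0; have [->//|nn0] := eqVneq n 0.
  (* For q = 0 the expression is affine in t, and this t gives it the value -1. *)
  have := K ((p + 1) / (2 * n)).
  have -> : p - 2 * ((p + 1) / (2 * n)) * n + ((p + 1) / (2 * n)) ^+ 2 * n * 0 = -1 by field.
  lra.
have qp : 0 < q by rewrite lt0r qn0.
(* For q > 0 and |u| nonzero, the quadratic attains its minimum at t = 1/q. *)
have := K (q^-1).
have -> : p - 2 * q^-1 * n + q^-1 ^+ 2 * n * q = p - n / q by field.
by rewrite subr_ge0 ler_pdivrMr.
Qed.

Section cstar_basics.
Context {R : realType} {A : cstarAlgType R}.
Implicit Types (a b w : A).

Lemma star1 : star (1 : A) = 1.
Proof. by rewrite -[LHS]mulr1 -{2}(starK 1) -starM mulr1 starK. Qed.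

Lemma cnorm1 : cnorm (1 : A) = 1.
Proof.
have := cnorm_star (1 : A); rewrite star1 mulr1 => /eqP.
rewrite expr2 -subr_eq0 -[X in X - _]mulr1 -mulrBr mulf_eq0 => /orP[/eqP/cnorm0_eq0/eqP|].
  by rewrite oner_eq0.
by rewrite subr_eq0 => /eqP.
Qed.

Lemma cnormX w n : cnorm (w ^+ n) <= cnorm w ^+ n.
Proof.
elim: n => [|n IH]; first by rewrite !expr0 cnorm1.
by rewrite !exprS; apply: le_trans (ler_cnormM _ _) _; apply: ler_wpM2l => //; exact: cnorm_ge0.
Qed.

Lemma starX w n : star (w ^+ n) = star w ^+ n.
Proof.
elim: n => [|n IH]; last by rewrite exprS exprSr starM IH.
by rewrite !expr0 star1.
Qed.

Section positive_functional.
Variable g : {linear A -> R[i]^o}.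
Hypothesis g_ge0 : forall w, 0 <= g (star w * w).

Lemma Cauchy_Schwarz_functional a b :
  Normc.normc (g (star a * b)) ^+ 2
    <= complex.Re (g (star a * a)) * complex.Re (g (star b * b)).
Proof.
have [|_ //] := @quadratic_form_ge0 R (g (star a * a)) (g (star b * b))
  (g (star a * b)) (g (star b * a)) (g_ge0 _) (g_ge0 _).
move=> c; have := g_ge0 (a + c *: b); rewrite starD starZ mulrDl !mulrDr.
rewrite -!scalerAl -!scalerAr scalerA !linearD !linearZ /= !addrA.
by rewrite /GRing.scale /= mulrA [c^* * c]mulrC.
Qed.

Lemma functional_Re_ge0 w : 0 <= complex.Re (g (star w * w)).
Proof. by have /ge0_complexP[] := g_ge0 w. Qed.

(* Iterating Cauchy-Schwarz against the powers p^(2^n) of p = w^* w replaces the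
   square root of |w|^2 - w^* w that the textbook proof requires. *)
Lemma functional_conj_le (M : R) w b :
  (forall a, Normc.normc (g a) <= M * cnorm a) ->
  complex.Re (g (star (w * b) * (w * b)))
    <= cnorm w ^+ 2 * complex.Re (g (star b * b)).
Proof.
move=> gM; pose p := star w * w.
have ps : star p = p by rewrite /p starM starK.
have pX n : star (p ^+ n) = p ^+ n by rewrite starX ps.
have -> : star (w * b) * (w * b) = star b * (p ^+ (2 ^ 0)) * b.
  by rewrite expn0 expr1 starM !mulrA.
rewrite -cnorm_star -/p.
pose G n := complex.Re (g (star b * (p ^+ (2 ^ n)) * b)).
pose Q := complex.Re (g (star b * b)).
have Q0 : 0 <= Q by exact: functional_Re_ge0.
(* Cauchy-Schwarz for b and p^(2^n) b; p is self-adjoint, so the exponent doubles. *)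
have GS n : G n ^+ 2 <= Q * G n.+1.
  have -> : G n.+1 = complex.Re (g (star (p ^+ (2 ^ n) * b) * (p ^+ (2 ^ n) * b))).
    by rewrite /G starM pX expnS mul2n -addnn exprD !mulrA.
  apply: le_trans (Cauchy_Schwarz_functional _ _).
  by rewrite /G !mulrA normc_sqr lerDl sqr_ge0.
have GM n : G n <= M * (cnorm (star b) * cnorm b) * cnorm p ^+ (2 ^ n).
  have M0 : 0 <= M.
    by have := gM 1; rewrite cnorm1 mulr1; apply: le_trans; exact: normc_ge0.
  apply: (@le_trans _ _ (Normc.normc (g (star b * (p ^+ (2 ^ n)) * b)))).
    exact: Re_le_normc.
  apply: le_trans (gM _) _; rewrite -[leRHS]mulrA; apply: ler_wpM2l => //.
  rewrite mulrAC; apply: le_trans (ler_cnormM _ _) _; apply: ler_wpM2r; first exact: cnorm_ge0.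
  apply: le_trans (ler_cnormM _ _) _; apply: ler_wpM2l; first exact: cnorm_ge0.
  exact: cnormX.
have p0 : 0 <= cnorm p by exact: cnorm_ge0.
rewrite -/(G 0) -/Q.
have [Q00|Qn0] := eqVneq Q 0.
  have := GS 0; rewrite Q00 mul0r mulr0 => /(conj (sqr_ge0 (G 0)))/andP/le_anti/esym/eqP.
  by rewrite sqrf_eq0 => /eqP ->.
have Qp : 0 < Q by rewrite lt0r Qn0.
(* Otherwise t = G 0 / Q exceeds |p|, and iterating [GS] gives Q t^(2^n) <= G n, which outgrows the
   bound K |p|^(2^n) from [GM]. *)
rewrite leNgt -ltr_pdivlMr//; apply/negP => pG.
set t := G 0 / Q in pG.
have tp : 0 < t by exact: le_lt_trans pG.
have GT n : Q * t ^+ (2 ^ n) <= G n.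
  elim: n => [|n IH]; first by rewrite expn0 expr1 /t mulrC divfK.
  have := GS n; rewrite mulrC -ler_pdivrMr//; apply: le_trans.
  rewrite ler_pdivlMr// expnS mul2n -addnn exprD.
  have -> : Q * (t ^+ (2 ^ n) * t ^+ (2 ^ n)) * Q = (Q * t ^+ (2 ^ n)) ^+ 2 by ring.
  by rewrite ler_sqr// nnegrE ?mulr_ge0 ?exprn_ge0// ?(ltW tp)//;
    apply: le_trans IH; rewrite mulr_ge0 ?exprn_ge0 ?(ltW tp).
set K := M * _ in GM.
have KK n : Q * t ^+ (2 ^ n) <= K * cnorm p ^+ (2 ^ n) by exact: le_trans (GT n) (GM n).
have [p00|pn0] := eqVneq (cnorm p) 0.
  have := KK 0; rewrite p00 expn0 !expr1 mulr0 leNgt => /negP; apply.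
  by rewrite mulr_gt0.
have pp : 0 < cnorm p by rewrite lt0r pn0.
pose s := t / cnorm p.
have s1 : 1 < s by rewrite /s ltr_pdivlMr// mul1r.
have bern n : n%:R * (s - 1) <= s ^+ n.
  elim: n => [|n IH]; first by rewrite mul0r.
  have : 1 <= s ^+ n by rewrite exprn_ege1// ltW.
  rewrite exprS -natr1; nra.
(* Chosen so that K / Q < n (s - 1) <= s^n <= s^(2^n), the middle inequality being Bernoulli's. *)
pose n := (Num.truncn (K / Q / (s - 1))).+1.
have nK : K / Q < n%:R * (s - 1).
  by rewrite -ltr_pdivrMr ?subr_gt0//; exact: truncnS_gt.
have nn : s ^+ n <= s ^+ (2 ^ n) by rewrite ler_eXn2l// ltnW// ltn_expl.
have := KK n; rewrite leNgt => /negP; apply.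
rewrite -ltr_pdivlMr ?exprn_gt0// -mulrA -expr_div_n -/s mulrC -ltr_pdivrMr//.
exact: lt_le_trans nK (le_trans (bern n) nn).
Qed.

(** Cauchy-Schwarz against 1, then [functional_conj_le] with b = 1: the unspecified bound M improves
    to 1. *)
Lemma functional_le_cnorm (M : R) w :
  (forall a, Normc.normc (g a) <= M * cnorm a) -> g 1 = 1 ->
  Normc.normc (g w) <= cnorm w.
Proof.
move=> gM g1; have := Cauchy_Schwarz_functional 1 w.
have := functional_conj_le w 1 gM.
rewrite star1 !mulr1 !mul1r g1 /= mul1r => h1 h2.
rewrite -ler_sqr ?nnegrE ?cnorm_ge0//; last exact: normc_ge0.
by apply: le_trans h2 _; rewrite mulr1 in h1.
Qed.

End positive_functional.
End cstar_basics.

(** * Real inequalities *)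

Section real_analysis.
Context {R : realType}.
Implicit Types (h : R -> R) (s t u : R).

Lemma powR_norm_continuous s : 0 <= s -> continuous (fun t : R => `|t| `^ s).
Proof.
rewrite le_eqVlt => /predU1P[<-|s0] t.
  by rewrite (_ : (fun _ => _) = cst 1); [exact: cst_continuous|apply/funext => ?; rewrite powRr0].
have [->|tn0] := eqVneq t 0.
  apply/cvgrPdist_lt => e e0; near=> v.
  rewrite normr0 powR0 ?gt_eqF// sub0r normrN ger0_norm ?powR_ge0//.
  (* At 0, the radius e^(1/s) serves for the tolerance e. *)
  have -> : e = (e `^ s^-1) `^ s by rewrite -powRrM mulVf ?gt_eqF// powRr1// ltW.
  apply: gt0_ltr_powR => //; rewrite ?nnegrE ?powR_ge0//.
  by near: v; have := @cvgr0_norm_lt R R^o; apply; [exact: cvg_id|rewrite powR_gt0].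
apply: (@continuous_comp _ _ _ (fun v : R => `|v|) (@powR R ^~ s)).
  exact: norm_continuous.
apply/differentiable_continuous/derivable1_diffP; apply: derivable_powR.
by rewrite in_itv/= andbT normr_gt0.
Unshelve. all: by end_near. Qed.

Lemma weighted_AMGM (a b alpha : R) : 0 <= a -> 0 <= b -> 0 <= alpha <= 1 ->
  a `^ alpha * b `^ (1 - alpha) <= alpha * a + (1 - alpha) * b.
Proof.
move=> a0 b0 /andP[]; rewrite le_eqVlt => /predU1P[<- _|al0].
  by rewrite powRr0 subr0 powRr1// !mul1r mul0r add0r.
rewrite le_eqVlt => /predU1P[->|al1].
  by rewrite subrr powRr0 powRr1// !mul1r mul0r addr0 mulr1.
have be0 : 0 < 1 - alpha by rewrite subr_gt0.
(* Young's inequality with exponents 1/alpha and 1/(1 - alpha), which is why the endpoints were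
   treated apart. *)
have := @conjugate_powR R (a `^ alpha) (b `^ (1 - alpha)) alpha^-1 (1 - alpha)^-1.
rewrite -!powRrM !mulfV ?gt_eqF// !powRr1// !invrK ![_ * alpha]mulrC ![_ * (1 - alpha)]mulrC.
by apply; rewrite ?powR_ge0 ?invr_gt0//; lra.
Qed.

Lemma convex_functionP h : convex_function (`[0, +oo[%classic : set R) h ->
  forall u v l, 0 <= u -> 0 <= v -> 0 <= l <= 1 ->
  h (l * u + (1 - l) * v) <= l * h u + (1 - l) * h v.
Proof.
move=> hc u v l u0 v0 /andP[l0 l1].
have := hc (Itv01 l0 l1) u v.
by rewrite !inE /= !in_itv /= !andbT !convRE /=; apply.
Qed.

(** Secant slopes to the left of s are at most those to the right, so m can be the supremum of the
    left slopes. Positivity of s provides a left slope, the one from 0. *)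
Lemma convex_subgradient h s :
  (forall u v l, 0 <= u -> 0 <= v -> 0 <= l <= 1 ->
    h (l * u + (1 - l) * v) <= l * h u + (1 - l) * h v) ->
  0 < s -> exists m, forall t, 0 <= t -> h s + m * (t - s) <= h t.
Proof.
move=> hc s0.
have slope u v : 0 <= u -> u < s -> s < v ->
    (h s - h u) / (s - u) <= (h v - h s) / (v - s).
  move=> u0 us sv; have vu : 0 < v - u by lra.
  have l01 : 0 <= (v - s) / (v - u) <= 1 by rewrite divr_ge0 ?ler_pdivrMr//=; lra.
  have := hc u v _ u0 (ltW (lt_trans s0 sv)) l01.
  have -> : (v - s) / (v - u) * u + (1 - (v - s) / (v - u)) * v = s by field; lra.
  have -> : 1 - (v - s) / (v - u) = (s - u) / (v - u) by field; lra.
  have -> : (v - s) / (v - u) * h u + (s - u) / (v - u) * h v =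
    ((v - s) * h u + (s - u) * h v) / (v - u) by field; lra.
  rewrite ler_pdivlMr// => H.
  rewrite ler_pdivrMr ?subr_gt0// mulrAC ler_pdivlMr ?subr_gt0//.
  nra.
pose S := [set (h s - h u) / (s - u) | u in [set u | 0 <= u < s]].
have S0 : S !=set0 by exists ((h s - h 0) / (s - 0)), 0 => //=; rewrite lexx.
have Sub v : s < v -> ubound S ((h v - h s) / (v - s)).
  by move=> sv _ [u /andP[u0 us] <-]; exact: slope.
exists (sup S) => t t0.
have [ts|st|->] := ltgtP t s; last by rewrite subrr mulr0 addr0.
  have : (h s - h t) / (s - t) <= sup S.
    apply: ub_le_sup; first by exists ((h (s + 1) - h s) / (s + 1 - s)); apply: Sub; lra.
    by exists t => //=; rewrite t0.
  by rewrite ler_pdivrMr ?subr_gt0//; lra.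
have : sup S <= (h t - h s) / (t - s) by apply: ge_sup => //; exact: Sub.
by rewrite ler_pdivlMr ?subr_gt0//; lra.
Qed.

(** The hypothesis at 0 covers a set without supremum, for which [sup] is 0; neither the existence
    of states nor a bound on their values then has to be shown. *)
Lemma le_sup_continuous (f : R -> R) (S : set R) (C : R) :
  continuous f -> f 0 <= C -> (forall n, S n -> f n <= C) -> f (sup S) <= C.
Proof.
move=> fc f0 fS; have [hS|hS] := pselect (has_sup S); last by rewrite sup_out.
rewrite leNgt; apply/negP => Cf.
have /cvgrPdist_lt/(_ (f (sup S) - C)) := fc (sup S).
rewrite subr_gt0 => /(_ Cf)[d /= d0 dP].
have [n Sn un] := sup_adherent d0 hS.
have nu : n <= sup S by apply: ub_le_sup => //; case: hS.
have /dP /= : ball_ [eta Num.norm] (sup S) d n by rewrite /ball_ /= ger0_norm; lra.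
by have := fS _ Sn; have := ler_norm (f (sup S) - f n); lra.
Qed.

End real_analysis.

(** * Functional calculus by real functions *)

Section ray_continuity.
Context {R : realType}.
Implicit Types (h k : R -> R).

(* Continuity on [0, +oo[, stated for the even extension so that the continuity
   lemmas for functions on R apply. *)
Definition ray_continuous h := continuous (fun t : R => h `|t|).

Lemma ray_continuousD h k :
  ray_continuous h -> ray_continuous k -> ray_continuous (h \+ k).
Proof. by move=> hc kc t; exact: (cvgD (hc t) (kc t)). Qed.

Lemma ray_continuousM h k :
  ray_continuous h -> ray_continuous k -> ray_continuous (h \* k).
Proof. by move=> hc kc t; exact: (cvgM (hc t) (kc t)). Qed.

Lemma continuous_ray h : continuous h -> ray_continuous h.
Proof.
by move=> hc t; apply: (@continuous_comp _ _ _ (fun s : R => `|s|) h);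
  [exact: norm_continuous|exact: hc].
Qed.

Lemma ray_continuous_comp h k : continuous h -> ray_continuous k -> ray_continuous (h \o k).
Proof. by move=> hc kc t; exact: (continuous_comp (kc t) (hc (k `|t|))). Qed.

Lemma ray_continuous_comp_ge0 h k : (forall t, 0 <= t -> 0 <= k t) ->
  ray_continuous h -> ray_continuous k -> ray_continuous (h \o k).
Proof.
move=> k0 hc kc.
rewrite /ray_continuous (_ : (fun t : R => _) = (fun s : R => h `|s|) \o (fun t : R => k `|t|)).
  by move=> t; exact: (continuous_comp (kc t) (hc (k `|t|))).
by apply/funext => t /=; congr h; rewrite [RHS]ger0_norm// k0.
Qed.

End ray_continuity.

Section real_functional_calculus.
Context {R : realType} {A : cstarAlgType R}.
Variables (a : A) (Phi : (R[i]^o -> R[i]^o) -> A).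
Hypotheses (a_ge0 : positive a) (Phi_calc : is_functional_calculus a Phi).
Implicit Types (h k : R -> R).

(** The body of [real_calculus] with [Phi] as a parameter: [real_power x r] is convertible to an
    [rcalc] of [functional_calculus x]. *)
Definition rcalc h : A := Phi (fun l => (h (complex.Re l))%:C).

Lemma positive_spectrumP (l : R[i]^o) : spectrum a l ->
  l = (complex.Re l)%:C /\ 0 <= complex.Re l.
Proof. by case: a_ge0 => _ /(_ l) + /[dup] => /[apply] /= /ge0_complexP. Qed.

(** On the spectrum Re l >= 0, so h may be replaced by its even extension, which is continuous
    everywhere. *)
Lemma ray_continuous_on_spectrum h : ray_continuous h ->
  continuous_on_spectrum a (fun l => (h (complex.Re l))%:C).
Proof.
move=> hc; apply: (@subspace_eq_continuous _ _ _
    (fun l : R[i]^o => (h `|complex.Re l|)%:C : R[i]^o)).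
  move=> l; rewrite inE => /positive_spectrumP[_ l0].
  by rewrite ger0_norm.
apply: continuous_subspaceT => l.
apply: (@continuous_comp _ _ _ (fun l : R[i]^o => h `|complex.Re l|)
  (fun t : R => t%:C : R[i]^o)); last exact: real_complex_continuous.
by apply: (@continuous_comp _ _ _ (@complex.Re R : R[i]^o -> R) (fun t : R => h `|t|));
  [exact: Re_continuous|exact: hc].
Qed.
Let cts := ray_continuous_on_spectrum.

Lemma rcalc_ext h k : ray_continuous h -> ray_continuous k ->
  (forall t, 0 <= t -> h t = k t) -> rcalc h = rcalc k.
Proof.
move=> hc kc hk; apply: (fcalc_ext Phi_calc); [exact: cts|exact: cts|].
by move=> l; rewrite inE => /positive_spectrumP[_ /hk ->].
Qed.

Lemma rcalcD h k : ray_continuous h -> ray_continuous k ->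
  rcalc (h \+ k) = rcalc h + rcalc k.
Proof.
move=> hc kc; rewrite -(fcalcD Phi_calc (cts hc) (cts kc)); congr Phi.
by apply/funext => l; rewrite /= rmorphD.
Qed.

Lemma rcalcM h k : ray_continuous h -> ray_continuous k ->
  rcalc (h \* k) = rcalc h * rcalc k.
Proof.
move=> hc kc; rewrite -(fcalcM Phi_calc (cts hc) (cts kc)); congr Phi.
by apply/funext => l; rewrite /= rmorphM.
Qed.

Lemma rcalcZ (c : R) h : ray_continuous h -> rcalc (fun t => c * h t) = c%:C *: rcalc h.
Proof.
move=> hc; rewrite -(fcalcZ Phi_calc c%:C (cts hc)); congr Phi.
by apply/funext => l; rewrite /= rmorphM.
Qed.

Lemma rcalc_star h : ray_continuous h -> star (rcalc h) = rcalc h.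
Proof.
move=> hc; rewrite -(fcalc_star Phi_calc (cts hc)); congr Phi.
by apply/funext => l; rewrite conjc_real.
Qed.

Lemma rcalc_cst (c : R) : rcalc (fun=> c) = c%:C%:A.
Proof.
have c1 : continuous_on_spectrum a (fun=> (1 : R[i]^o)).
  by apply: continuous_subspaceT => l; exact: cst_continuous.
by rewrite -(fcalc1 Phi_calc) -(fcalcZ Phi_calc _ c1); congr Phi; apply/funext => l; rewrite mulr1.
Qed.

Lemma rcalc_id : rcalc id = a.
Proof.
rewrite -[RHS](fcalc_id Phi_calc); apply: (fcalc_ext Phi_calc).
- by apply: (@cts id); apply: continuous_ray => t; exact: cvg_id.
- by apply: continuous_subspaceT => l; exact: cvg_id.
- by move=> l; rewrite inE => /positive_spectrumP[<- _].
Qed.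

(* h is the mean of the functions h +- i sqrt (c^2 - h^2), of constant modulus c. *)
Lemma rcalc_norm h (c : R) : ray_continuous h ->
  (forall t, 0 <= t -> `|h t| <= c) -> cnorm (rcalc h) <= c.
Proof.
move=> hc hle; have c0 : 0 <= c by exact: le_trans (hle 0 _).
pose k t := Num.sqrt (c ^+ 2 - h t ^+ 2).
have h2c : ray_continuous (h \* h) by exact: ray_continuousM.
have kc : ray_continuous k.
  apply: (@ray_continuous_comp _ (fun t : R => Num.sqrt (c ^+ 2 - t ^+ 2))) => // t.
  apply: (@continuous_comp R R R (fun t : R => c ^+ 2 - t ^+ 2) Num.sqrt);
    last exact: sqrt_continuous.
  by apply: cvgB; [exact: cvg_cst|exact: exprn_continuous].
have hk : rcalc h * rcalc h + rcalc k * rcalc k = (c ^+ 2)%:C%:A.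
  rewrite -!rcalcM// -rcalcD//; last exact: ray_continuousM.
  rewrite -rcalc_cst; apply: rcalc_ext.
  - by apply: ray_continuousD => //; exact: ray_continuousM.
  - by apply: continuous_ray => t; exact: cst_continuous.
  - move=> t t0 /=; rewrite -[k t * k t]expr2 sqr_sqrtr; first by ring.
    by rewrite subr_ge0 -real_normK ?num_real// ler_sqr ?nnegrE// hle.
have comm : rcalc h * rcalc k = rcalc k * rcalc h.
  by rewrite -!rcalcM//; congr rcalc; apply/funext => t /=; rewrite mulrC.
(* Used for j = i and j = -i. As h(a) and k(a) are self-adjoint and commute, (h - j k)(h + j k) =
   h^2 + k^2 = c^2, and the C*-identity gives the norm. *)
have unit (j : R[i]) : j^* = - j -> j * j = -1 -> cnorm (rcalc h + j *: rcalc k) = c.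
  move=> jc jj; apply/eqP; rewrite -(@eqrXn2 _ 2) ?cnorm_ge0//; apply/eqP.
  have -> : c ^+ 2 = cnorm ((c ^+ 2)%:C%:A : A).
    by rewrite cnormZ cnorm1 mulr1 /= expr0n /= addr0 sqrtr_sqr ger0_norm ?sqr_ge0.
  have jS : star (j *: rcalc k) = - (j *: rcalc k).
    by rewrite starZ rcalc_star// -scaleNr; congr (_ *: _).
  rewrite -cnorm_star starD rcalc_star// jS -hk; congr cnorm.
  rewrite mulrDl !mulrDr !mulNr -!scalerAl -!scalerAr -comm.
  by rewrite scalerA jj scaleN1r opprK addrA addrK.
have -> : rcalc h = (2^-1 : R)%:C *: ((rcalc h + 'i *: rcalc k) + (rcalc h + (- 'i) *: rcalc k)).
  have e2 : (2^-1 : R)%:C * (1 + 1) = 1 :> R[i].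
    by apply/eqP; rewrite eq_complex /=; apply/andP; split; apply/eqP; field.
  by rewrite scaleNr addrACA subrr addr0 -[X in _ = _ *: (X + X)]scale1r
     -scalerDl scalerA e2 scale1r.
rewrite cnormZ /= expr0n addr0 sqrtr_sqr; apply: (@le_trans _ _ (2^-1 * (c + c))); last lra.
rewrite ger0_norm ?invr_ge0// ler_wpM2l ?invr_ge0//.
apply: le_trans (ler_cnormD _ _) _.
by rewrite !unit//; apply/eqP; rewrite eq_complex /=; apply/andP; split; apply/eqP; ring.
Qed.

End real_functional_calculus.

(** * Bump functions *)

Section ray_bumps.
Context {R : realType}.

Lemma continuous_max (f g : R -> R) : continuous f -> continuous g ->
  continuous (fun t => Num.max (f t) (g t)).
Proof.
move=> fc gc t; rewrite (_ : (fun t => _) = (fun t => ((f t + g t) + `|f t - g t|) / 2)).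
  apply: cvgM; last exact: cvg_cst.
  apply: cvgD; first exact: cvgD (fc t) (gc t).
  exact: (cvg_norm (cvgB (fc t) (gc t))).
by apply/funext => s; case: (leP (f s) (g s)) => fg;
  [rewrite ler0_norm|rewrite gtr0_norm]; lra.
Qed.

(* Piecewise linear: 1 within distance d of s, 0 beyond distance 2 d. *)
Definition bump (s d t : R) : R := Num.max 0 (1 - Num.max 0 (`|t - s| / d - 1)).

Lemma bump_continuous s d : continuous (bump s d).
Proof.
rewrite /bump; apply: (@continuous_max (fun=> 0)
  (fun t => 1 - Num.max 0 (`|t - s| / d - 1))) => t; first exact: cvg_cst.
apply: cvgB; first exact: cvg_cst.
apply: (@continuous_max (fun=> 0) (fun t => `|t - s| / d - 1)) => {}t; first exact: cvg_cst.
apply: cvgB; last exact: cvg_cst.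
apply: cvgM; last exact: cvg_cst.
by apply: cvg_norm; apply: cvgB; [exact: cvg_id|exact: cvg_cst].
Qed.

Lemma bump01 s d t : 0 <= bump s d t <= 1.
Proof. by rewrite /bump le_max lexx ge_max ler01 /= lerBlDr lerDl le_max lexx. Qed.

Lemma bump1 s d t : 0 < d -> `|t - s| <= d -> bump s d t = 1.
Proof.
move=> d0 td; rewrite /bump (max_l (_ : _ / d - 1 <= 0)) ?subr0 ?max_r ?ler01//.
by rewrite subr_le0 ler_pdivrMr// mul1r.
Qed.

Lemma bump0 s d t : 0 < d -> 2 * d <= `|t - s| -> bump s d t = 0.
Proof.
move=> d0 td; have : 1 <= `|t - s| / d - 1 by rewrite lerBrDr ler_pdivlMr.
by move=> H; rewrite /bump max_l// subr_le0 le_max H orbT.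
Qed.

End ray_bumps.

(** * Spectral mapping and composition of functional calculi *)

Section spectral_mapping.
Context {R : realType} {A : cstarAlgType R}.
Variables (a : A) (Phi : (R[i]^o -> R[i]^o) -> A).
Hypotheses (a_ge0 : positive a) (Phi_calc : is_functional_calculus a Phi).
Implicit Types (h k : R -> R).
Local Notation rcalc := (rcalc Phi).

Lemma ray_continuous_cstB (c : R) k : ray_continuous k -> ray_continuous (fun t => c - k t).
Proof. by move=> kc t; apply: cvgB; [exact: cvg_cst|exact: kc]. Qed.

Lemma rcalc_cstB (c : R) k : ray_continuous k -> rcalc (fun t => c - k t) = c%:C%:A - rcalc k.
Proof.
move=> kc.
have -> : rcalc (fun t => c - k t) = rcalc ((fun=> c) \+ (fun t => (-1) * k t)).
  by congr rcalc; apply/funext => t; rewrite /= mulN1r.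
rewrite (rcalcD a_ge0 Phi_calc); [|by move=> t; exact: cvg_cst|].
  by rewrite (rcalc_cst Phi_calc) (rcalcZ a_ge0 Phi_calc)// rmorphN scaleN1r.
by move=> t; apply: cvgM; [exact: cvg_cst|exact: kc].
Qed.

(* If k(s) - k(a) is invertible, then the elements h(a) with h supported where k is
   close to k(s) are small; a bump absorbed by another small bump is then 0, and
   (1 - bump)(t) / (s - t) provides an inverse of s - a. *)
Lemma spectral_mapping_subset k (s : R) : ray_continuous k -> 0 <= s ->
  spectrum a s%:C -> spectrum (rcalc k) (k s)%:C.
Proof.
move=> kc s0 sa [b [bl br]]; apply: sa.
pose f t := k s - k t.
have fc : ray_continuous f by exact: ray_continuous_cstB.
have fE : rcalc f = (k s)%:C%:A - rcalc k by exact: rcalc_cstB.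
(* Makes |b| e <= 1/2, where b is the inverse of k(s) - k(a). *)
pose e := (2 * (cnorm b + 1))^-1.
have b0 : 0 <= cnorm b by exact: cnorm_ge0.
have e0 : 0 < e by rewrite invr_gt0; lra.
have [d d0 fd] : exists2 d, 0 < d & forall t, 0 <= t -> `|t - s| < d -> `|f t| < e.
  have /cvgrPdist_lt/(_ _ e0)[d /= d0 dP] := kc s.
  exists d => // t t0 ts.
  have /dP : ball_ [eta Num.norm] s d t by rewrite /ball_ /= distrC.
  by rewrite /= [`|s|]ger0_norm// [`|t|]ger0_norm.
(* [h2] vanishes beyond distance d/2 from s, where [h1] stops being known to be 1, and [h1] vanishes
   beyond d, where |f| < e is no longer available. *)
pose h1 := bump s (d / 2); pose h2 := bump s (d / 4).
have h1c : ray_continuous h1 by apply: continuous_ray; exact: bump_continuous.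
have h2c : ray_continuous h2 by apply: continuous_ray; exact: bump_continuous.
have h12 : rcalc h1 * rcalc h2 = rcalc h2.
  rewrite -(rcalcM a_ge0 Phi_calc)//; congr rcalc; apply/funext => t /=.
  have [td|td] := leP `|t - s| (d / 2).
    by rewrite /h1 bump1 ?mul1r// divr_gt0.
  by rewrite /h2 bump0 ?mulr0 ?divr_gt0//; lra.
have fh1 : cnorm (rcalc (f \* h1)) <= e.
  apply: (rcalc_norm a_ge0 Phi_calc); first exact: ray_continuousM.
  move=> t t0 /=; rewrite normrM.
  have [td|td] := ltP `|t - s| d.
    have /andP[? ?] := bump01 s (d / 2) t.
    by rewrite -[e]mulr1 ler_pM// ?(ltW (fd _ _ _))// ger0_norm.
  by rewrite /h1 bump0 ?normr0 ?mulr0; [exact: ltW|lra|lra].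
have nh1 : cnorm (rcalc h1) <= 2^-1.
  have -> : rcalc h1 = b * rcalc (f \* h1).
    by rewrite (rcalcM a_ge0 Phi_calc)// fE mulrA br mul1r.
  apply: le_trans (ler_cnormM _ _) _; apply: le_trans (ler_wpM2l b0 fh1) _.
  rewrite /e ler_pdivrMr; lra.
(* |h2(a)| = |h1(a) h2(a)| <= |h2(a)| / 2. *)
have h20 : rcalc h2 = 0.
  apply: cnorm0_eq0; have := ler_cnormM (rcalc h1) (rcalc h2).
  rewrite h12 => H; have n0 := cnorm_ge0 (rcalc h2).
  have := ler_wpM2r n0 nh1; lra.
(* This is (1 - h2)/(s - t) made continuous: the denominator (s - t)^2 is kept away from 0 by a
   cutoff that acts only within distance d/4 of s, where 1 - h2 = 0. *)
pose q t := (1 - h2 t) * (s - t) / Num.max ((s - t) ^+ 2) ((d / 4) ^+ 2).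
have dd t : 0 < Num.max ((s - t) ^+ 2) ((d / 4) ^+ 2).
  by rewrite lt_max [X in _ || X]exprn_gt0 ?orbT// divr_gt0.
have stc : continuous (fun t : R => s - t).
  by move=> t; apply: cvgB; [exact: cvg_cst|exact: cvg_id].
have qc : ray_continuous q.
  apply: continuous_ray => t; apply: cvgM.
    by apply: cvgM; [apply: cvgB; [exact: cvg_cst|exact: bump_continuous]|exact: stc].
  apply: cvgV; first by rewrite gt_eqF.
  apply: (@continuous_max _ (fun t => (s - t) ^+ 2) (fun=> (d / 4) ^+ 2)) => [{}t|{}t];
    last exact: cvg_cst.
  apply: (@continuous_comp R R R (fun t => s - t) (fun u => u ^+ 2));
    [exact: stc|exact: exprn_continuous].
have stE : rcalc (fun t => s - t) = s%:C%:A - a.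
  by rewrite (@rcalc_cstB s id) ?(rcalc_id a_ge0 Phi_calc)//;
    apply: continuous_ray => t; exact: cvg_id.
have qst : rcalc (q \* (fun t => s - t)) = 1.
  have -> : rcalc (q \* (fun t => s - t)) = rcalc (fun t => 1 - h2 t).
    congr rcalc; apply/funext => t; rewrite /q /=.
    have [td|td] := leP `|t - s| (d / 4).
      by rewrite /h2 bump1 ?divr_gt0//; ring.
    have dst : (d / 4) ^+ 2 <= (s - t) ^+ 2.
      have d40 : 0 <= d / 4 by lra.
      by rewrite -[leRHS]real_normK ?num_real// distrC ler_sqr ?nnegrE ?normr_ge0// ltW.
    rewrite max_l//.
    have : s - t != 0 by rewrite -normr_gt0 distrC; apply: lt_trans td; rewrite divr_gt0.
    by move=> st; field.
  by rewrite rcalc_cstB// h20 subr0 rmorph1 scale1r.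
exists (rcalc q); rewrite -stE -!(rcalcM a_ge0 Phi_calc)//; try exact: continuous_ray.
by split => //; rewrite -[RHS]qst; congr rcalc; apply/funext => t /=; rewrite mulrC.
Qed.

(** For a number x + iy outside [0, +oo[, the function D = (x - k)^2 + y^2 is positive on the ray,
    and ((x - k) - iy) / D yields an explicit inverse of x + iy - k(a). *)
Lemma rcalc_positive k : ray_continuous k -> (forall t, 0 <= t -> 0 <= k t) ->
  positive (rcalc k).
Proof.
move=> kc k0; split; first exact: (rcalc_star a_ge0 Phi_calc).
move=> [x y] xy /=; apply: contrapT => nxy; apply: xy.
pose D t := (x - k t) ^+ 2 + y ^+ 2.
have D0 t : 0 <= t -> 0 < D t.
  move=> t0; rewrite lt0r addr_ge0 ?sqr_ge0// andbT; apply/negP.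
  rewrite paddr_eq0 ?sqr_ge0// !sqrf_eq0 subr_eq0 => /andP[/eqP xk /eqP y0].
  by apply: nxy; rewrite xk y0 lecE /= eqxx k0.
have Dc : ray_continuous D.
  apply: (ray_continuous_comp (h := fun u => (x - u) ^+ 2 + y ^+ 2)) => // t.
  apply: cvgD; last exact: cvg_cst.
  apply: (@continuous_comp R R R (fun u : R => x - u) (fun u => u ^+ 2));
    last exact: exprn_continuous.
  by apply: cvgB; [exact: cvg_cst|exact: cvg_id].
have Vc : ray_continuous (fun t => (D t)^-1).
  by move=> t; apply: cvgV; [rewrite gt_eqF// D0|exact: Dc].
pose F := rcalc (fun t => x - k t); pose V := rcalc (fun t => (D t)^-1).
pose J : A := (0 +i* y) *: 1.
have Fc : ray_continuous (fun t => x - k t) by exact: ray_continuous_cstB.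
have xyE : (x +i* y)%:A - rcalc k = F + J.
  have -> : x +i* y = x%:C + (0 +i* y) by apply/eqP; rewrite eq_complex /= addr0 add0r !eqxx.
  by rewrite scalerDl /F rcalc_cstB// addrAC.
have FV : F * V = V * F.
  by rewrite -!(rcalcM a_ge0 Phi_calc)//; congr rcalc; apply/funext => t /=; rewrite mulrC.
have FJ u : J * u = u * J by rewrite /J -scalerAl -scalerAr mul1r mulr1.
have JJ : - (J * J) = rcalc (fun=> y ^+ 2).
  rewrite (rcalc_cst Phi_calc) /J -scalerAl mul1r scalerA -scaleNr; congr (_ *: _).
  by apply/eqP; rewrite eq_complex /=; apply/andP; split; apply/eqP; ring.
have DE : F * F - J * J = rcalc D.
  rewrite JJ -(rcalcM a_ge0 Phi_calc)// -(rcalcD a_ge0 Phi_calc).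
  - by congr rcalc; apply/funext => t; rewrite /D /= expr2.
  - exact: ray_continuousM.
  - by move=> t; exact: cvg_cst.
have c1 : ray_continuous (fun=> 1 : R) by move=> t; exact: cvg_cst.
have FFV : (F * F - J * J) * V = 1.
  rewrite DE -(rcalcM a_ge0 Phi_calc)//.
  have -> : rcalc (D \* (fun t => (D t)^-1)) = rcalc (fun=> 1).
    apply: (rcalc_ext a_ge0 Phi_calc) => //; first exact: ray_continuousM.
    by move=> t t0 /=; rewrite mulfV// gt_eqF// D0.
  by rewrite (rcalc_cst Phi_calc) rmorph1 scale1r.
exists ((F - J) * V); rewrite xyE; split.
  rewrite mulrA -[RHS]FFV; congr (_ * _).
  by rewrite mulrDl !mulrBr FJ addrA subrK.
rewrite -mulrA mulrDr -FV -FJ -mulrDl mulrA -[RHS]FFV; congr (_ * _).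
by rewrite mulrBl !mulrDr FJ opprD addrA addrK.
Qed.

(** By [spectral_mapping_subset], l |-> k(Re l) sends the spectrum of a into that of k(a), so
    relative continuity composes. *)
Lemma continuous_on_spectrum_comp k (f : R[i]^o -> R[i]^o) : ray_continuous k ->
  continuous_on_spectrum (rcalc k) f ->
  continuous_on_spectrum a (fun l => f (k (complex.Re l))%:C).
Proof.
move=> kc /subspace_continuousP fc; apply/subspace_continuousP => l la.
have inj m : spectrum a m -> spectrum (rcalc k) (k (complex.Re m))%:C.
  move=> /[dup] ma /(positive_spectrumP a_ge0)[mE m0].
  by apply: spectral_mapping_subset => //; rewrite -mE.
have /subspace_continuousP/(_ _ la) pc := ray_continuous_on_spectrum a_ge0 kc.
apply: cvg_comp (fc _ (inj _ la)) => P PP.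
apply: (filterS (F := nbhs (l : R[i]^o))) (pc _ PP) => m mP ma.
by apply: (mP ma); exact: inj.
Qed.

(** Ensures that [functional_calculus (rcalc Phi k)] is a genuine calculus and not the default
    value. *)
Lemma is_functional_calculus_rcalc k : ray_continuous k ->
  is_functional_calculus (rcalc k) (fun f => Phi (fun l => f (k (complex.Re l))%:C)).
Proof.
move=> kc; have ctsc f := @continuous_on_spectrum_comp k f kc.
split.
- move=> f g fc gc fg; apply: (fcalc_ext Phi_calc); [exact: ctsc|exact: ctsc|].
  move=> l; rewrite inE => /[dup] la /(positive_spectrumP a_ge0)[lE l0].
  by apply: fg; rewrite inE; apply: spectral_mapping_subset => //; rewrite -lE.
- by move=> f g fc gc; exact: (fcalcD Phi_calc (ctsc _ fc) (ctsc _ gc)).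
- by move=> c f fc; exact: (fcalcZ Phi_calc c (ctsc _ fc)).
- by move=> f g fc gc; exact: (fcalcM Phi_calc (ctsc _ fc) (ctsc _ gc)).
- by move=> f fc; exact: (fcalc_star Phi_calc (ctsc _ fc)).
- exact: (fcalc1 Phi_calc).
- by [].
Qed.

End spectral_mapping.

(** * Jensen's inequality for states *)

Section Jensen.
Context {R : realType} {A : cstarAlgType R}.
Variables (a : A) (Phi : (R[i]^o -> R[i]^o) -> A).
Hypotheses (a_ge0 : positive a) (Phi_calc : is_functional_calculus a Phi).
Variable g : {linear A -> R[i]^o}.
Hypotheses (g_ge0 : forall w, 0 <= g (star w * w)) (g1 : g 1 = 1).
Implicit Types (h k : R -> R).
Local Notation rcalc := (rcalc Phi).
Local Notation G w := (complex.Re (g w)).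

Lemma ReD_functional u v : G (u + v) = G u + G v.
Proof. by rewrite linearD; case: (g u) (g v) => [? ?] []. Qed.

Lemma ReZ_functional (c : R) u : G (c%:C *: u) = c * G u.
Proof. by rewrite linearZ /=; case: (g u) => p q /=; rewrite mul0r subr0. Qed.

(** A nonnegative h is the square of its root k, so h(a) = k(a)^* k(a). *)
Lemma functional_rcalc_ge0 h : ray_continuous h -> (forall t, 0 <= t -> 0 <= h t) ->
  0 <= G (rcalc h).
Proof.
move=> hc h0; pose k t := Num.sqrt (h t).
have kc : ray_continuous k by apply: ray_continuous_comp hc; exact: sqrt_continuous.
have -> : rcalc h = star (rcalc k) * rcalc k.
  rewrite (rcalc_star a_ge0 Phi_calc)// -(rcalcM a_ge0 Phi_calc)//.
  apply: (rcalc_ext a_ge0 Phi_calc) => //; first exact: ray_continuousM.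
  by move=> t t0 /=; rewrite -expr2 sqr_sqrtr// h0.
exact: functional_Re_ge0.
Qed.

(** With s = g(k(a)), a supporting line of h at s makes h(k) - h(s) - m (k - s) nonnegative on the
    ray; apply g, for which the linear term vanishes. *)
Lemma state_Jensen h k :
  (forall u v l, 0 <= u -> 0 <= v -> 0 <= l <= 1 ->
    h (l * u + (1 - l) * v) <= l * h u + (1 - l) * h v) ->
  h 0 = 0 -> (forall t, 0 <= t -> 0 <= h t) -> ray_continuous h ->
  (forall t, 0 <= t -> 0 <= k t) -> ray_continuous k ->
  h (G (rcalc k)) <= G (rcalc (h \o k)).
Proof.
move=> hconv h00 h0 hc k0 kc.
have hkc : ray_continuous (h \o k) by exact: ray_continuous_comp_ge0.
have s0 : 0 <= G (rcalc k) by exact: functional_rcalc_ge0.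
(* A supporting line is available only at s > 0; at s = 0 the claim follows from h 0 = 0 and
   positivity. *)
have [->|sn0] := eqVneq (G (rcalc k)) 0.
  by rewrite h00; apply: functional_rcalc_ge0 => // t t0 /=; rewrite h0 ?k0.
set s := G (rcalc k) in s0 sn0 *.
have [m hm] : exists m, forall t, 0 <= t -> h s + m * (t - s) <= h t.
  by apply: convex_subgradient => //; rewrite lt0r sn0.
have mkc : ray_continuous (fun t => - m * k t) by move=> t; apply: cvgM; [exact: cvg_cst|exact: kc].
have cc : ray_continuous (fun=> m * s - h s) by move=> t; exact: cvg_cst.
have := @functional_rcalc_ge0 ((h \o k) \+ ((fun t => - m * k t) \+ (fun=> m * s - h s))).
rewrite (rcalcD a_ge0 Phi_calc)//; last exact: ray_continuousD.
rewrite (rcalcD a_ge0 Phi_calc)// (rcalcZ a_ge0 Phi_calc)// (rcalc_cst Phi_calc).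
rewrite !ReD_functional !ReZ_functional g1 /= -/s => H.
have : 0 <= G (rcalc (h \o k)) + (- m * s + (m * s - h s) * 1).
  apply: H => [|t t0 /=]; first by apply: ray_continuousD => //; exact: ray_continuousD.
  have := hm (k t) (k0 _ t0); lra.
lra.
Qed.

Lemma powR_ray_continuous (s : R) : 0 <= s -> ray_continuous (fun t => t `^ s).
Proof. by move=> s0; exact: powR_norm_continuous. Qed.

(** Jensen for t^p with p = r / (2 alpha), applied to a^(2 alpha) and then raised to the power
    alpha; p >= 1 because r >= 2 and alpha <= 1. For alpha = 0 both sides are 1. *)
Lemma state_McCarthy (r alpha : R) : 2 <= r -> 0 <= alpha <= 1 ->
  G (rcalc (fun t => t `^ (2 * alpha))) `^ (r / 2) <= G (rcalc (fun t => t `^ r)) `^ alpha.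
Proof.
move=> r2 /andP[]; rewrite le_eqVlt => /predU1P[<- _|al0 al1].
  rewrite mulr0 powRr0 (_ : (fun t => t `^ 0) = fun=> 1); last by apply/funext => t; rewrite powRr0.
  by rewrite (rcalc_cst Phi_calc) ReZ_functional g1 /= mulr1 powR1.
pose p := r / (2 * alpha).
have p1 : 1 <= p by rewrite /p ler_pdivlMr; lra.
have -> : r / 2 = p * alpha by rewrite /p; field; lra.
rewrite powRrM; apply: (ge0_ler_powR (ltW al0)); rewrite ?nnegrE ?powR_ge0//.
  apply: functional_rcalc_ge0 => [|t _]; last exact: powR_ge0.
  by apply: powR_ray_continuous; lra.
have -> : (fun t : R => t `^ r) = (fun u => u `^ p) \o (fun t => t `^ (2 * alpha)).
  by apply/funext => t /=; rewrite -powRrM; congr (_ `^ _); rewrite /p; field; lra.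
apply: (@state_Jensen (fun u => u `^ p)).
- exact: convex_functionP (convex_powR p1).
- by rewrite powR0// gt_eqF//; lra.
- by move=> t _; exact: powR_ge0.
- by apply: powR_ray_continuous; lra.
- by move=> t _; exact: powR_ge0.
- by apply: powR_ray_continuous; lra.
Qed.

End Jensen.

(** * Default values of suprema and of missing functional calculi *)

Section junk_values.
Context {R : realType} {A : cstarAlgType R}.

Lemma numerical_radius0 : numerical_radius (0 : A) = 0.
Proof.
rewrite /numerical_radius.
have S0 : [set Normc.normc (g (0 : A)) | g in states] `<=` [set 0].
  by move=> _ [g _ <-] /=; rewrite linear0 /= expr0n addr0 sqrtr0.
by have [->|->] := subset_set1 S0; rewrite ?sup0 ?sup1.
Qed.

Lemma numerical_radius_ge0 (w : A) : 0 <= numerical_radius w.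
Proof.
have [hS|hS] := pselect (has_sup [set Normc.normc (g w) | g in states]); last first.
  by rewrite /numerical_radius sup_out.
have [[n Sn] ubS] := hS; apply: (@le_trans _ _ n); last exact: ub_le_sup.
by case: Sn => g _ <-; exact: normc_ge0.
Qed.

Lemma functional_calculusP (a : A) Phi : is_functional_calculus a Phi ->
  is_functional_calculus a (functional_calculus a).
Proof.
move=> aPhi; rewrite /functional_calculus.
exact: (@xgetPex _ (fun=> 0) [set Psi | is_functional_calculus a Psi]) (ex_intro _ Phi aPhi).
Qed.

Lemma real_power_no_calculus (a : A) s : ~ (exists Phi, is_functional_calculus a Phi) -> real_power a s = 0.
Proof.
move=> aPhi; rewrite /real_power /real_calculus /functional_calculus xgetPN// => Phi aP.
by apply: aPhi; exists Phi.
Qed.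

End junk_values.

(** * The numerical radius inequality *)

Section state_bound.
Context {R : realType} {A : cstarAlgType R}.
Variables (x z : A) (Phi Psi : (R[i]^o -> R[i]^o) -> A).
Hypotheses (x_ge0 : positive x) (x_calc : is_functional_calculus x Phi).
Hypotheses (z_ge0 : positive z) (z_calc : is_functional_calculus z Psi).
Variable g : {linear A -> R[i]^o}.
Hypothesis gS : states g.
Local Notation G w := (complex.Re (g w)).
Let pw (s : R) := fun t : R => t `^ s.

Lemma rcalc_sqr_powR (a : A) Theta s : positive a -> is_functional_calculus a Theta -> 0 <= s ->
  star (rcalc Theta (pw s)) * rcalc Theta (pw s) = rcalc Theta (pw (2 * s)).
Proof.
move=> a0 ac s0; have pc (u : R) : 0 <= u -> ray_continuous (pw u) by exact: powR_ray_continuous.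
rewrite (rcalc_star a0 ac (pc _ s0)) -(rcalcM a0 ac (pc _ s0) (pc _ s0)).
by congr rcalc; apply/funext => t; rewrite /pw /= [2 * s]mulrC powRrM powR_mulrn ?powR_ge0// expr2.
Qed.

Lemma state_numerical_bound (y : A) (r alpha : R) : 2 <= r -> 0 <= alpha <= 1 ->
  Normc.normc (g (rcalc Phi (pw alpha) * y * rcalc Psi (pw (1 - alpha)))) `^ r
    <= cnorm y `^ r *
       (alpha * G (rcalc Phi (pw r)) + (1 - alpha) * G (rcalc Psi (pw r))).
Proof.
move: gS => [[M gM] g_ge0 g1] r2 al01; have /andP[al0 al1] := al01.
have be01 : 0 <= 1 - alpha <= 1 by lra.
have r0 : 0 <= r / 2 by lra.
have be0 : 0 <= 1 - alpha by lra.
set X := rcalc Phi _; set Z := rcalc Psi (pw (1 - _)).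
set P := rcalc Phi _; set Q := rcalc Psi _.
set n := Normc.normc _.
have n0 : 0 <= n by exact: normc_ge0.
have y0 : 0 <= cnorm y by exact: cnorm_ge0.
pose X2 := G (rcalc Phi (pw (2 * alpha))); pose Z2 := G (rcalc Psi (pw (2 * (1 - alpha)))).
have X20 : 0 <= X2.
  by rewrite /X2 -(rcalc_sqr_powR x_ge0 x_calc al0); exact: functional_Re_ge0.
have Z20 : 0 <= Z2.
  by rewrite /Z2 -(rcalc_sqr_powR z_ge0 z_calc be0); exact: functional_Re_ge0.
have P0 : 0 <= G P.
  by apply: (functional_rcalc_ge0 x_ge0 x_calc g_ge0) => [|t _];
    [apply: powR_ray_continuous; lra|exact: powR_ge0].
have Q0 : 0 <= G Q.
  by apply: (functional_rcalc_ge0 z_ge0 z_calc g_ge0) => [|t _];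
    [apply: powR_ray_continuous; lra|exact: powR_ge0].
(* Cauchy-Schwarz separates X from y Z, X being self-adjoint; [functional_conj_le] then extracts
   |y|^2 from g((y Z)^* (y Z)). *)
have nle : n ^+ 2 <= cnorm y ^+ 2 * (X2 * Z2).
  have Xs : star X = X by rewrite (rcalc_star x_ge0 x_calc)//; exact: powR_ray_continuous.
  rewrite /n -mulrA -{1}Xs; apply: le_trans (Cauchy_Schwarz_functional g_ge0 _ _) _.
  rewrite (rcalc_sqr_powR x_ge0 x_calc al0) -/X2 mulrCA ler_wpM2l//.
  by rewrite /Z2 -(rcalc_sqr_powR z_ge0 z_calc be0); exact: (functional_conj_le g_ge0 y Z gM).
have sqrE (u : R) : 0 <= u -> u `^ r = (u ^+ 2) `^ (r / 2).
  by move=> u0; rewrite -powR_mulrn// -powRrM; congr (_ `^ _); field.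
rewrite sqrE//; apply: (le_trans (ge0_ler_powR r0 _ _ nle)); rewrite ?nnegrE ?sqr_ge0//.
  by rewrite !mulr_ge0 ?sqr_ge0.
rewrite powRM ?sqr_ge0 ?mulr_ge0// -sqrE// ler_wpM2l ?powR_ge0// powRM//.
apply: le_trans (weighted_AMGM P0 Q0 al01).
apply: ler_pM; rewrite ?powR_ge0//.
- exact: (state_McCarthy x_ge0 x_calc g_ge0 g1 r2 al01).
- exact: (state_McCarthy z_ge0 z_calc g_ge0 g1 r2 be01).
Qed.

End state_bound.

(** Jensen is applied to w = x^r with w's own calculus and k = id, so phi(x^r) stays an iterated
    calculus and is never rewritten as one function of x. *)
Lemma state_Jensen_real_power (R : realType) (A : cstarAlgType R)
    (phi : R -> R) (x : A) (g : {linear A -> R[i]^o}) (r : R) :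
  orlicz_function phi -> positive x -> (exists Phi, is_functional_calculus x Phi) ->
  states g -> 0 <= r ->
  0 <= complex.Re (g (real_power x r)) /\
  phi (complex.Re (g (real_power x r))) <= complex.Re (g (real_calculus phi (real_power x r))).
Proof.
move=> [phi_ge0 phi_cont phi_conv _ [phi0 _ _]] x0 [Phi xPhi] [_ g_ge0 g1] r0.
have xc := functional_calculusP xPhi.
have pc := powR_ray_continuous r0.
have wE : real_power x r = rcalc (functional_calculus x) (fun t => t `^ r) by [].
have w0 : positive (real_power x r).
  by rewrite wE; apply: (rcalc_positive x0 xc pc) => t _; exact: powR_ge0.
have wc : is_functional_calculus (real_power x r) (functional_calculus (real_power x r)).
  rewrite {1}wE; apply: functional_calculusP; exact: (is_functional_calculus_rcalc x0 xc pc).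
split; first by rewrite wE; apply: (functional_rcalc_ge0 x0 xc g_ge0 pc) => t _; exact: powR_ge0.
have idc : ray_continuous (id : R -> R) by apply: continuous_ray => t; exact: cvg_id.
have := state_Jensen w0 wc g_ge0 g1 (convex_functionP phi_conv) phi0 phi_ge0
  (within_continuous_norm phi_cont) (fun t (t0 : 0 <= t) => t0) idc.
by rewrite (rcalc_id w0 wc).
Qed.

Theorem theorem2p33 (R : realType) (A : cstarAlgType R) (x y z : A)
    (phi : R -> R) (r alpha : R) :
  orlicz_function phi -> sub_multiplicative phi ->
  positive x -> positive z -> 2 <= r -> 0 <= alpha <= 1 ->
  phi (numerical_radius (real_power x alpha * y * real_power z (1 - alpha)) `^ r)
    <= phi (cnorm y `^ r)
       * cnorm (alpha%:C *: real_calculus phi (real_power x r)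
                + (1 - alpha)%:C *: real_calculus phi (real_power z r)).
Proof.
move=> phiO phiM x0 z0 r2 al01.
have [phi_ge0 phi_cont phi_conv phi_mono [phi0 _ _]] := phiO.
have r0 : 0 <= r by lra.
set W := _ *: _ + _; set T := _ * real_power z _.
have C0 : 0 <= phi (cnorm y `^ r) * cnorm W.
  by rewrite mulr_ge0 ?cnorm_ge0// phi_ge0// powR_ge0.
have phi0r : phi (0 `^ r) = 0 by rewrite powR0 ?phi0// gt_eqF//; lra.
have [xc|nxc] := pselect (exists Phi, is_functional_calculus x Phi); last first.
  by rewrite /T (real_power_no_calculus _ nxc) !mul0r numerical_radius0 phi0r.
have [zc|nzc] := pselect (exists Phi, is_functional_calculus z Phi); last first.
  by rewrite /T (real_power_no_calculus _ nzc) mulr0 numerical_radius0 phi0r.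
pose f t := phi (t `^ r).
have fc : ray_continuous f.
  apply: (@ray_continuous_comp_ge0 _ phi (fun t => t `^ r)) => [t _||].
  - exact: powR_ge0.
  - exact: within_continuous_norm.
  - exact: powR_ray_continuous.
have v0 : 0 <= numerical_radius T by exact: numerical_radius_ge0.
(* The numerical radius is nonnegative, so f may be replaced by its even extension, whose continuity
   on [R] reduces the claim to single states. *)
rewrite -(ger0_norm v0) -/(f _); apply: (@le_sup_continuous _ (fun t => f `|t|)) => //.
  by rewrite /f normr0 phi0r.
move=> _ [g gS <-]; rewrite /f ger0_norm; last exact: normc_ge0.
have [px0 px] := state_Jensen_real_power phiO x0 xc gS r0.
have [pz0 pz] := state_Jensen_real_power phiO z0 zc gS r0.
have [al0 al1] := andP al01.
have [Phi xPhi] := xc; have [Psi zPsi] := zc.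
have := state_numerical_bound x0 (functional_calculusP xPhi)
  z0 (functional_calculusP zPsi) gS y r2 al01.
set gx := complex.Re (g (real_power x r)) in px0 px *.
set gz := complex.Re (g (real_power z r)) in pz0 pz *.
have m0 : 0 <= alpha * gx + (1 - alpha) * gz.
  by rewrite addr_ge0// mulr_ge0// subr_ge0.
move=> /(phi_mono _ _ (powR_ge0 _ _))/le_trans; apply.
apply: le_trans (phiM _ _ (powR_ge0 _ _) m0) _.
apply: ler_wpM2l; first exact/phi_ge0/powR_ge0.
apply: le_trans (convex_functionP phi_conv px0 pz0 al01) _.
have [[M gM] g_ge0 g1] := gS.
(* The norm of W is reached through Re g(W) <= |g(W)| <= |W|; the two Jensen bounds then compare
   termwise with Re g(W). *)
apply: le_trans (functional_le_cnorm g_ge0 W gM g1).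
apply: le_trans (Re_le_normc _).
rewrite /W ReD_functional !ReZ_functional.
by apply: lerD; apply: ler_wpM2l => //; rewrite subr_ge0.
Qed.
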